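(* $\mathsf{GS4^c}$ has finitely many $\{\neg,\Box,\Diamond\}$-modalities.
   Context: Fix a set $\mathrm{Prop}$ of propositional symbols. Modal formulas are given by the grammar $\varphi := \bot \mid p \mid \varphi\land\varphi \mid \varphi\lor\varphi \mid \varphi\to\varphi \mid \Box\varphi \mid \Diamond\varphi$ with $p\in\mathrm{Prop}$; $\Box$ and $\Diamond$ are not interdefinable. Put $\neg\varphi := \varphi\to\bot$. A relation is a preorder if it is reflexive and transitive. For a relation $R$ on $W$, a set $A\subseteq W$ is an $R$-upset iff $w\in A$ and $wRv$ imply $v\in A$. A birelational $\mathsf{CS4}$-model is a tuple $M=\langle W, W^\bot, \preceq, \sqsubseteq, V\rangle$ where $W$ is a set of worlds, $W^\bot\subseteq W$ is the set of fallible worlds, $\preceq$ and $\sqsubseteq$ are preorders on $W$, and $V:\mathrm{Prop}\to\mathcal{P}(W)$, such that: (i) $M$ is backward confluent: $w\sqsubseteq v\preceq v'$ implies there is $w'$ with $w\preceq w'$ and $w'\sqsubseteq v'$; (ii) for every $p\in\mathrm{Prop}$, $V(p)$ is a $\preceq$-upset and $W^\bot\subseteq V(p)$; (iii) $W^\bot$ is both a $\preceq$-upset and a $\sqsubseteq$-upset. A $\mathsf{GS4^c}$-model is a $\mathsf{CS4}$-model with $W^\bot=\emptyset$ which is (backward confluent and) forward confluent: $w\sqsubseteq v$ and $w\preceq w'$ imply there is $v'$ with $w'\sqsubseteq v'$ and $v\preceq v'$; downward confluent: $w\preceq v\sqsubseteq v'$ implies there is $w'$ with $w\sqsubseteq w'$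 and $w'\preceq v'$; and locally linear: $w\preceq v$ and $w\preceq u$ imply $v\preceq u$ or $u\preceq v$. Truth: $M,w\models p$ iff $w\in V(p)$; $M,w\models\bot$ iff $w\in W^\bot$; $\land,\lor$ are evaluated pointwise; $M,w\models\varphi\to\psi$ iff for all $v$ with $w\preceq v$, $M,v\models\varphi$ implies $M,v\models\psi$; $M,w\models\Box\varphi$ iff for all $v,u$ with $w\preceq v$ and $v\sqsubseteq u$, $M,u\models\varphi$; $M,w\models\Diamond\varphi$ iff for all $v$ with $w\preceq v$ there is $u$ with $v\sqsubseteq u$ and $M,u\models\varphi$. Write $\|\varphi\|^M := \{w\in W\mid M,w\models\varphi\}$. For $X\subseteq\{\neg,\Box,\Diamond\}$, an $X$-modality is a finite (possibly empty) sequence $\sigma\in X^{<\omega}$; $\sigma\varphi$ denotes the formula obtained by prefixing $\sigma$ to $\varphi$. Modalities $\sigma,\tau$ are $\mathsf{GS4^c}$-equivalent if $\|\sigma\varphi\|^M=\|\tau\varphi\|^M$ for every $\mathsf{GS4^c}$-model $M$ and every formula $\varphi$. $\mathsf{GS4^c}$ has finitely many $X$-modalities iff there is a finite set $\Sigma\subseteq X^{<\omega}$ such that every $X$-modality is $\mathsf{GS4^c}$-equivalent to some $\sigma\in\Sigma$; otherwise it has infinitely many $X$-modalities. *)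

(* Defs.v *)
From Stdlib Require Import List Relations Ensembles Finite_sets.

Set Implicit Arguments.

Inductive formula (Atom : Type) : Type :=
| Bot : formula Atom
| Var : Atom -> formula Atom
| And : formula Atom -> formula Atom -> formula Atom
| Or : formula Atom -> formula Atom -> formula Atom
| Imp : formula Atom -> formula Atom -> formula Atom
| Box : formula Atom -> formula Atom
| Dia : formula Atom -> formula Atom.

Arguments Bot {Atom}.

Definition Neg (Atom : Type) (f : formula Atom) : formula Atom := Imp f Bot.

Section Frames.

Variables (W : Type) (le acc : relation W).

Definition upset (R : relation W) (A : Ensemble W) : Prop :=
  forall w v, In W A w -> R w v -> In W A v.

Definition backward_confluent : Prop :=
  forall w v v', acc w v -> le v v' -> exists w', le w w' /\ acc w' v'.

Definition forward_confluent : Prop :=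
  forall w v w', acc w v -> le w w' -> exists v', acc w' v' /\ le v v'.

Definition downward_confluent : Prop :=
  forall w v v', le w v -> acc v v' -> exists w', acc w w' /\ le w' v'.

Definition locally_linear : Prop :=
  forall w v u, le w v -> le w u -> le v u \/ le u v.

End Frames.

(* [le] is the intuitionistic preorder, [acc] the modal one. *)
Record CS4_model (Atom : Type) : Type := {
  world : Type;
  fallible : Ensemble world;
  le : relation world;
  acc : relation world;
  val : Atom -> Ensemble world;
  le_preorder : preorder world le;
  acc_preorder : preorder world acc;
  le_acc_backward : backward_confluent le acc;
  val_upset : forall p, upset le (val p);
  fallible_val : forall p, Included world fallible (val p);
  fallible_le_upset : upset le fallible;
  fallible_acc_upset : upset acc fallible
}.

Arguments fallible {Atom}.
Arguments le {Atom}.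
Arguments acc {Atom}.
Arguments val {Atom}.

Record GS4c_model (Atom : Type) (M : CS4_model Atom) : Prop := {
  no_fallible : Same_set (world M) (fallible M) (Empty_set (world M));
  le_acc_forward : forward_confluent (le M) (acc M);
  le_acc_downward : downward_confluent (le M) (acc M);
  le_linear : locally_linear (le M)
}.

Fixpoint sat (Atom : Type) (M : CS4_model Atom) (w : world M)
    (f : formula Atom) {struct f} : Prop :=
  match f with
  | Bot => In (world M) (fallible M) w
  | Var p => In (world M) (val M p) w
  | And g h => sat M w g /\ sat M w h
  | Or g h => sat M w g \/ sat M w h
  | Imp g h => forall v, le M w v -> sat M v g -> sat M v h
  | Box g => forall v u, le M w v -> acc M v u -> sat M u g
  | Dia g => forall v, le M w v -> exists u, acc M v u /\ sat M u g
  end.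

Definition truth_set (Atom : Type) (M : CS4_model Atom) (f : formula Atom) :
    Ensemble (world M) :=
  fun w => sat M w f.

Inductive modop : Type := neg | box | dia.

Definition modality : Type := list modop.

Definition X_modality (X : Ensemble modop) : Ensemble modality :=
  fun s => Forall (In modop X) s.

Definition app_op (Atom : Type) (o : modop) (f : formula Atom) : formula Atom :=
  match o with
  | neg => Neg f
  | box => Box f
  | dia => Dia f
  end.

(* The head of the list is the outermost operator. *)
Definition app_modality (Atom : Type) (s : modality) (f : formula Atom) :
    formula Atom :=
  fold_right (@app_op Atom) f s.

Definition GS4c_equivalent (Atom : Type) (s t : modality) : Prop :=
  forall M : CS4_model Atom, GS4c_model M -> forall f : formula Atom,
    Same_set (world M) (truth_set M (app_modality s f))
      (truth_set M (app_modality t f)).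

Definition GS4c_finitely_many_modalities (Atom : Type) (X : Ensemble modop) :
    Prop :=
  exists S : Ensemble modality,
    Finite modality S /\ Included modality S (X_modality X) /\
    forall t, In modality (X_modality X) t ->
      exists s, In modality S s /\ GS4c_equivalent Atom t s.

(* Main.v *)
Require Import Defs.
From Stdlib Require Import Ensembles.
From Stdlib Require Import List Relations Finite_sets Classical Setoid Morphisms.
Import ListNotations.

(** In a model satisfying all three confluence conditions, [Box] and [Dia] can
    be evaluated at the current world only, as in classical modal logic: truth
    is preserved upwards, so downward confluence removes the quantifier over
    [le] from the clause of [Box] and forward confluence removes it from that
    of [Dia]. Hence the words in [box] and [dia] obey the laws of an interior
    and a closure operator, and up to equivalence there are at most seven of
    them ([s4_words], [s4_words_cons]).

    Negation is brought under control by two commutation laws. Backward and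
    downward confluence give [neg dia = box neg] ([neg_dia]). Local linearity
    makes the double negation of [f] true at [w] exactly when [f] holds
    somewhere above [w]: the worlds above [w] form a chain, so one such world
    makes [f] true cofinally often ([sat_neg_neg]). Read in this way, downward
    and backward confluence say that double negation commutes with [dia]
    ([neg_neg_dia]).

    Consequently the regular modalities, those absorbing a double negation,
    are closed under [box] and [dia], and on them [neg] satisfies both De
    Morgan laws. Everything of the form [neg s] is regular, so outside
    the innermost negation of a word all other negations can be moved inwards,
    exchanging [box] and [dia] on the way, and cancelled there in pairs. Each
    word thus becomes [b], [a neg b] or [a neg neg b] with [a] and [b] among
    the seven words in [box] and [dia] ([normal_form]), which leaves at most
    7 + 2 * 49 classes. *)

(** * Truth in models with all confluence conditions *)

Section Truth.

Context {Atom : Type} (M : CS4_model Atom).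

Lemma le_refl w : le M w w.
Proof. apply (le_preorder M). Qed.

Lemma le_trans w v u : le M w v -> le M v u -> le M w u.
Proof. apply (le_preorder M). Qed.

Lemma acc_refl w : acc M w w.
Proof. apply (acc_preorder M). Qed.

Lemma acc_trans w v u : acc M w v -> acc M v u -> acc M w u.
Proof. apply (acc_preorder M). Qed.

Lemma sat_persistent w v f : sat M w f -> le M w v -> sat M v f.
Proof.
  revert w v.
  induction f as [|p|g IHg h IHh|g IHg h IHh|g _ h _|g _|g _];
    simpl; intros w v Hw Hwv.
  - now apply (fallible_le_upset M w v).
  - now apply (val_upset M p w v).
  - destruct Hw; split; eauto.
  - destruct Hw; eauto.
  - eauto using le_trans.
  - eauto using le_trans.
  - eauto using le_trans.
Qed.

Context (G : GS4c_model M).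

Lemma sat_box w f : sat M w (Box f) <-> forall u, acc M w u -> sat M u f.
Proof.
  split; simpl.
  - eauto using le_refl.
  - intros H v u Hwv Hvu.
    destruct (le_acc_downward G _ _ _ Hwv Hvu) as (w' & Hww' & Hw'u).
    exact (sat_persistent _ _ f (H w' Hww') Hw'u).
Qed.

Lemma sat_dia w f : sat M w (Dia f) <-> exists u, acc M w u /\ sat M u f.
Proof.
  split; simpl.
  - eauto using le_refl.
  - intros (u & Hwu & Hu) v Hwv.
    destruct (le_acc_forward G _ _ _ Hwu Hwv) as (u' & Hvu' & Huu').
    exists u'; split; [assumption|].
    exact (sat_persistent _ _ f Hu Huu').
Qed.

Lemma sat_neg w f : sat M w (Neg f) <-> forall v, le M w v -> ~ sat M v f.
Proof.
  split; simpl.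
  - intros H v Hwv Hv.
    destruct (proj1 (no_fallible G) v (H v Hwv Hv)).
  - intros H v Hwv Hv. destruct (H v Hwv Hv).
Qed.

(** The worlds above [w] form a chain on which truth is preserved upwards, so
    a single world of this chain satisfying [f] prevents [Neg f] from holding
    anywhere above [w]. *)
Lemma sat_neg_neg w f :
  sat M w (Neg (Neg f)) <-> exists v, le M w v /\ sat M v f.
Proof.
  rewrite sat_neg. split.
  - intros H. apply NNPP. intros Hno. apply (H w (le_refl w)).
    apply sat_neg. eauto.
  - intros (v & Hwv & Hv) u Hwu Hu. rewrite sat_neg in Hu.
    destruct (le_linear G _ _ _ Hwv Hwu) as [Hvu|Huv].
    + exact (Hu u (le_refl u) (sat_persistent _ _ f Hv Hvu)).
    + exact (Hu v Huv Hv).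
Qed.

End Truth.

(** * Laws of equivalent modalities *)

Section Modalities.

Context {Atom : Type}.

Local Notation "s ~~ t" := (GS4c_equivalent Atom s t) (at level 70).

Lemma equivalent_sat s t :
  s ~~ t <->
  forall M : CS4_model Atom, GS4c_model M -> forall f w,
    sat M w (app_modality s f) <-> sat M w (app_modality t f).
Proof.
  split.
  - intros H M G f w. destruct (H M G f) as [H1 H2].
    split; [apply H1 | apply H2].
  - intros H M G f. split; intros w; apply (H M G f w).
Qed.

#[local] Instance equivalent_equivalence :
  Equivalence (GS4c_equivalent Atom).
Proof.
  split.
  - intros s. apply equivalent_sat. reflexivity.
  - intros s t. rewrite !equivalent_sat. intros H M G f w.
    symmetry. now apply H.
  - intros s t u. rewrite !equivalent_sat. intros H1 H2 M G f w.
    rewrite (H1 M G f w). now apply H2.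
Qed.

#[local] Instance cons_proper o :
  Proper (GS4c_equivalent Atom ==> GS4c_equivalent Atom) (cons o).
Proof.
  intros s t. rewrite !equivalent_sat. intros H M G f w.
  specialize (H M G f).
  destruct o; simpl app_modality; simpl app_op.
  - rewrite !(sat_neg M G). now setoid_rewrite H.
  - rewrite !(sat_box M G). now setoid_rewrite H.
  - rewrite !(sat_dia M G). now setoid_rewrite H.
Qed.

Lemma app_equivalent a s t : s ~~ t -> a ++ s ~~ a ++ t.
Proof.
  intros H. induction a as [|o a IH]; simpl; [assumption|].
  now rewrite IH.
Qed.

Lemma box_box s : box :: box :: s ~~ box :: s.
Proof.
  apply equivalent_sat. intros M G f w; simpl app_modality; simpl app_op.
  rewrite !(sat_box M G). setoid_rewrite (sat_box M G).
  split; eauto using acc_refl, acc_trans.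
Qed.

Lemma dia_dia s : dia :: dia :: s ~~ dia :: s.
Proof.
  apply equivalent_sat. intros M G f w; simpl app_modality; simpl app_op.
  rewrite !(sat_dia M G). setoid_rewrite (sat_dia M G).
  split.
  - intros (u & Hwu & v & Huv & Hv). eauto using acc_trans.
  - intros (u & Hwu & Hu). eauto using acc_refl.
Qed.

Lemma box_dia_box_dia s : box :: dia :: box :: dia :: s ~~ box :: dia :: s.
Proof.
  apply equivalent_sat. intros M G f w; simpl app_modality; simpl app_op.
  rewrite !(sat_box M G). setoid_rewrite (sat_dia M G).
  setoid_rewrite (sat_box M G). setoid_rewrite (sat_dia M G).
  split; intros H u Hwu.
  - destruct (H u Hwu) as (v & Huv & Hv).
    destruct (Hv v (acc_refl M v)) as (x & Hvx & Hx).
    eauto using acc_trans.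
  - exists u. eauto using acc_refl, acc_trans.
Qed.

Lemma dia_box_dia_box s : dia :: box :: dia :: box :: s ~~ dia :: box :: s.
Proof.
  apply equivalent_sat. intros M G f w; simpl app_modality; simpl app_op.
  rewrite !(sat_dia M G). setoid_rewrite (sat_box M G).
  setoid_rewrite (sat_dia M G). setoid_rewrite (sat_box M G).
  split.
  - intros (u & Hwu & Hu).
    destruct (Hu u (acc_refl M u)) as (v & Huv & Hv).
    eauto using acc_trans.
  - intros (u & Hwu & Hu). exists u. split; [assumption|].
    intros v Huv. exists v. eauto using acc_refl, acc_trans.
Qed.

Lemma neg_neg_neg s : neg :: neg :: neg :: s ~~ neg :: s.
Proof.
  apply equivalent_sat. intros M G f w; simpl app_modality; simpl app_op.
  rewrite (sat_neg M G w (Neg _)), (sat_neg M G w).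
  setoid_rewrite (sat_neg_neg M G).
  split.
  - intros H v Hwv Hv. apply (H v Hwv). eauto using le_refl.
  - intros H v Hwv (u & Hvu & Hu). apply (H u); eauto using le_trans.
Qed.

(** Both sides say that [s] fails at every world reachable from the current
    one, by [le] then [acc] on the left and by [acc] then [le] on the right.
    Backward and downward confluence turn one kind of path into the other. *)
Lemma neg_dia s : neg :: dia :: s ~~ box :: neg :: s.
Proof.
  apply equivalent_sat. intros M G f w; simpl app_modality; simpl app_op.
  rewrite (sat_neg M G), (sat_box M G).
  setoid_rewrite (sat_neg M G). setoid_rewrite (sat_dia M G).
  split.
  - intros H u Hwu v Huv Hv.
    destruct (le_acc_backward M _ _ _ Hwu Huv) as (w' & Hww' & Hw'v).
    apply (H w' Hww'). eauto.
  - intros H v Hwv (u & Hvu & Hu).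
    destruct (le_acc_downward G _ _ _ Hwv Hvu) as (w' & Hww' & Hw'u).
    exact (H w' Hww' u Hw'u Hu).
Qed.

(** Double negation is a possibility operator for [le], hence commutes with
    [dia] by the same exchange of paths as in [neg_dia]. *)
Lemma neg_neg_dia s : neg :: neg :: dia :: s ~~ dia :: neg :: neg :: s.
Proof.
  apply equivalent_sat. intros M G f w; simpl app_modality; simpl app_op.
  rewrite (sat_neg_neg M G), (sat_dia M G).
  setoid_rewrite (sat_neg_neg M G). setoid_rewrite (sat_dia M G).
  split.
  - intros (v & Hwv & u & Hvu & Hu).
    destruct (le_acc_downward G _ _ _ Hwv Hvu) as (w' & Hww' & Hw'u).
    eauto.
  - intros (u & Hwu & v & Huv & Hv).
    destruct (le_acc_backward M _ _ _ Hwu Huv) as (w' & Hww' & Hw'v).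
    eauto.
Qed.

(** * Words in box and diamond *)

Definition s4_words : list modality :=
  [[]; [box]; [dia]; [box; dia]; [dia; box]; [box; dia; box]; [dia; box; dia]].

(** Quantifying over the tail [s] lets the reduction act on the part of a word
    to the left of its negations. *)
Lemma s4_words_cons o a :
  o <> neg -> In a s4_words ->
  exists a', In a' s4_words /\ forall s, o :: a ++ s ~~ a' ++ s.
Proof.
  intros Ho Ha. destruct o; [congruence| |].
  - simpl in Ha; decompose [or] Ha; subst; try tauto.
    + exists [box]. split; [simpl; tauto | reflexivity].
    + exists [box]. split; [simpl; tauto | apply box_box].
    + exists [box; dia]. split; [simpl; tauto | reflexivity].
    + exists [box; dia]. split; [simpl; tauto | intros; apply box_box].
    + exists [box; dia; box]. split; [simpl; tauto | reflexivity].
    + exists [box; dia; box]. split; [simpl; tauto | intros; apply box_box].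
    + exists [box; dia].
      split; [simpl; tauto | intros; apply box_dia_box_dia].
  - simpl in Ha; decompose [or] Ha; subst; try tauto.
    + exists [dia]. split; [simpl; tauto | reflexivity].
    + exists [dia; box]. split; [simpl; tauto | reflexivity].
    + exists [dia]. split; [simpl; tauto | intros; apply dia_dia].
    + exists [dia; box; dia]. split; [simpl; tauto | reflexivity].
    + exists [dia; box]. split; [simpl; tauto | intros; apply dia_dia].
    + exists [dia; box].
      split; [simpl; tauto | intros; apply dia_box_dia_box].
    + exists [dia; box; dia]. split; [simpl; tauto | intros; apply dia_dia].
Qed.

(** * Regular modalities and normal forms *)

Definition regular (s : modality) : Prop := neg :: neg :: s ~~ s.

Lemma regular_neg s : regular (neg :: s).
Proof. apply neg_neg_neg. Qed.

Lemma regular_box s : regular s -> regular (box :: s).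
Proof.
  unfold regular; intros Hs.
  rewrite <- Hs at 1. now rewrite <- neg_dia, neg_neg_neg, neg_dia, Hs.
Qed.

Lemma regular_dia s : regular s -> regular (dia :: s).
Proof. unfold regular; intros Hs. now rewrite neg_neg_dia, Hs. Qed.

(** Rewriting [s] as [neg neg s] gives [neg box neg neg s], which is
    [neg neg dia neg s]; the double negation passes through [dia] and is then
    absorbed. *)
Lemma neg_box_regular s : regular s -> neg :: box :: s ~~ dia :: neg :: s.
Proof.
  unfold regular; intros Hs.
  rewrite <- Hs at 1.
  now rewrite <- neg_dia, neg_neg_dia, neg_neg_neg.
Qed.

Definition dual (o : modop) : modop :=
  match o with neg => neg | box => dia | dia => box end.

Lemma s4_words_dual a : In a s4_words -> In (map dual a) s4_words.
Proof. simpl. intuition (subst; simpl; tauto). Qed.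

Lemma s4_words_positive a : In a s4_words -> ~ In neg a.
Proof. simpl. intuition (subst; simpl in *; intuition discriminate). Qed.

Lemma regular_app a s : ~ In neg a -> regular s -> regular (a ++ s).
Proof.
  induction a as [|o a IH]; simpl; [auto|]; intros Ha Hs.
  destruct o; [tauto|apply regular_box|apply regular_dia]; tauto.
Qed.

Lemma neg_app_regular a s :
  ~ In neg a -> regular s -> neg :: a ++ s ~~ map dual a ++ neg :: s.
Proof.
  induction a as [|o a IH]; simpl; intros Ha Hs; [reflexivity|].
  destruct o; simpl.
  - tauto.
  - rewrite neg_box_regular by (apply regular_app; tauto).
    now rewrite IH by tauto.
  - rewrite neg_dia. now rewrite IH by tauto.
Qed.

Definition normal_words : list modality :=
  s4_words ++
  flat_map (fun a =>
    flat_map (fun n => map (fun b => a ++ n ++ b) s4_words)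
      [[neg]; [neg; neg]])
    s4_words.

Lemma in_normal_words s :
  In s normal_words <->
  In s s4_words \/
  exists a n b, In a s4_words /\ In n [[neg]; [neg; neg]] /\
    In b s4_words /\ s = a ++ n ++ b.
Proof.
  unfold normal_words. rewrite in_app_iff, in_flat_map.
  setoid_rewrite in_flat_map. setoid_rewrite in_map_iff.
  firstorder eauto 10.
Qed.

Lemma normal_form t : exists s, In s normal_words /\ t ~~ s.
Proof.
  setoid_rewrite in_normal_words.
  induction t as [|o t (s & Hs & Hts)].
  - exists []. split; [left; simpl; auto | reflexivity].
  - setoid_rewrite Hts. clear t Hts.
    destruct (classic (o = neg)) as [->|Ho];
      destruct Hs as [Hs|(a & n & b & Ha & Hn & Hb & ->)].
    + exists (neg :: s). split; [|reflexivity].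
      right. exists [], [neg], s. simpl. auto 10.
    + pose proof (s4_words_positive a Ha) as Hpos.
      (* The new negation passes through [a] and lands on [n], where two
         negations stay and a third one cancels. *)
      destruct Hn as [<-|[<-|[]]].
      * exists (map dual a ++ [neg; neg] ++ b). split.
        -- right. exists (map dual a), [neg; neg], b.
           pose proof (s4_words_dual a Ha). simpl In at 2. auto 10.
        -- exact (neg_app_regular a _ Hpos (regular_neg b)).
      * exists (map dual a ++ [neg] ++ b). split.
        -- right. exists (map dual a), [neg], b.
           pose proof (s4_words_dual a Ha). simpl In at 2. auto 10.
        -- simpl app. rewrite (neg_app_regular a _ Hpos (regular_neg _)).
           apply app_equivalent, neg_neg_neg.
    + destruct (s4_words_cons o s Ho Hs) as (s' & Hs' & Heq).
      exists s'. split; [auto|].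
      specialize (Heq []). now rewrite !app_nil_r in Heq.
    + destruct (s4_words_cons o a Ho Ha) as (a' & Ha' & Heq).
      exists (a' ++ n ++ b). split; [|apply Heq].
      right. exists a', n, b. auto.
Qed.

End Modalities.

(** * Finiteness *)

(** The constructors of [Finite] only add new elements, so duplicates in [l]
    have to be skipped. *)
Lemma finite_of_list (U : Type) (l : list U) :
  exists S, Finite U S /\ forall x, Ensembles.In U S x <-> In x l.
Proof.
  induction l as [|y l (S & HS & HSl)].
  - exists (Empty_set U). split; [constructor|].
    intros x. split; intros [].
  - destruct (classic (Ensembles.In U S y)) as [Hy|Hy].
    + exists S. split; [assumption|].
      intros x. simpl. rewrite <- HSl. split; [auto|].
      intros [<-|Hx]; assumption.
    + exists (Ensembles.Add U S y). split; [now constructor|].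
      intros x. simpl. rewrite <- HSl. split.
      * intros [z Hz|z []]; auto.
      * intros [->|Hx]; [right; constructor | now left].
Qed.

Theorem theorem18 (Atom : Type) :
  GS4c_finitely_many_modalities Atom (Triple modop neg box dia).
Proof.
  destruct (finite_of_list _ normal_words) as (S & HS & HSl).
  exists S. split; [assumption|]. split.
  - intros s _. apply Forall_forall. intros [] _; constructor.
  - intros t _. destruct (normal_form (Atom := Atom) t) as (s & Hs & Hts).
    exists s. split; [now apply HSl | assumption].
Qed.
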